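(* For every integer $n\ge 4$ which is a power of two, there is a voting tree $\Psi$ with leaves labeled by elements of $[n]$ such that for every $\alpha\in[n]$ and every perfect manipulator tournament $T$ on the vertex set $[n]$ with $\alpha$ as the manipulator, $\alpha$ does not win when $\Psi$ is applied to $T$, i.e. $\Psi(T)\neq\alpha$.
   Context: Write $[n]=\{1,\dots,n\}$. A tournament is an oriented complete graph: every pair of distinct vertices spans exactly one directed edge; $\overrightarrow{ij}\in T$ means that $i$ defeats $j$. The match between $i$ and $j$ on $T$ returns $i$ if $i=j$ or $\overrightarrow{ij}\in T$, and returns $j$ otherwise. A voting tree is a finite (not necessarily complete) binary tree in which each node has either 0 or 2 children and each leaf is labeled by an element of $[n]$; several leaves may receive the same label. Given a tournament $T$ on $[n]$, a voting tree $\Theta$ is evaluated by recursively labeling each internal node by the result of the match on $T$ between the labels of its two children; the label at the root is the winner, denoted $\Theta(T)$. A perfect manipulator tournament is an $n$-vertex tournament whose vertex set is a disjoint union $\{\alpha\}\cup B\cup C$, where $B$ and $C$ are nonempty, the single element $\alpha$ (the manipulator) defeats every member of $B$, every member of $B$ defeats every member of $C$, and every member of $C$ defeats $\alpha$ (edges within $B$ and within $C$ are arbitrary). *)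

(* Defs.v *)
From mathcomp Require Import all_boot.

Set Implicit Arguments.
Unset Strict Implicit.
Unset Printing Implicit Defensive.

(* [T i j] reads "i defeats j". *)
Definition tournament (V : finType) (T : rel V) : Prop :=
  irreflexive T /\ forall i j : V, i != j -> T i j (+) T j i.

Definition match_winner (V : finType) (T : rel V) (i j : V) : V :=
  if (i == j) || T i j then i else j.

Inductive voting_tree (V : Type) : Type :=
| Leaf of V
| Node of voting_tree V & voting_tree V.

Fixpoint winner (V : finType) (T : rel V) (t : voting_tree V) : V :=
  match t with
  | Leaf i => i
  | Node l r => match_winner T (winner T l) (winner T r)
  end.

Definition perfect_manipulator_tournament (V : finType) (T : rel V) (a : V)
    : Prop :=
  tournament T /\
  exists B C : {set V},
    [/\ B != set0, C != set0 &
     [/\ a \notin B, a \notin C, [disjoint B & C] &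
         a |: (B :|: C) = [set: V]]] /\
    [/\ forall b, b \in B -> T a b,
        forall b c, b \in B -> c \in C -> T b c &
        forall c, c \in C -> T c a].

(* Main.v *)
Require Import Defs.
From mathcomp Require Import all_boot all_algebra.
Import GRing.Theory.

Set Implicit Arguments.
Unset Strict Implicit.
Unset Printing Implicit Defensive.

(** In a perfect manipulator tournament, give the manipulator the colour 0, the
    members of B the colour 1 and those of C the colour 2.  Colour x beats
    colour x + 1 modulo 3, so a match is a round of rock-paper-scissors between
    colours, and the colour of the winner of a tree is determined by the colours
    of its leaves.  The manipulator is the only vertex of colour 0; hence it
    loses as soon as the tree returns a colour that two distinct vertices share.
    With at least four vertices and three colours such a pair exists, and the
    point is to build a tree that finds one.

    All is made from one gadget, [step z us]: every tree of [us] plays z, and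
    then z and the results play each other.  The outcome has the colour of z
    lowered by 1 if that smaller colour occurs among [us], and the colour of z
    otherwise ([colour_step]).
    - Played against all the leaves, where every colour occurs, [step] always
      lowers the colour by 1.  So subtraction and addition of 1 are available
      ([colour_down], [colour_up]).
    - From x and y one then forms four trees that have all three colours if x
      and y have different colours, and one common colour otherwise.  Played
      against them, [step] tells the two cases apart, which gives a tree
      [if_same x y z] with the colour of x if x and y agree, and that of z
      otherwise ([colour_if_same_eq], [colour_if_same_neq]).
    Chaining [if_same] over all pairs of distinct vertices returns the colour of
    the first monochromatic pair. *)

Local Open Scope ring_scope.

(** * Rock-paper-scissors modulo 3 *)

Definition rps (x y : 'Z_3) : 'Z_3 := if y == x - 1 then y else x.

Lemma Z3_cases (x y : 'Z_3) : [\/ y = x, y = x + 1 | y = x - 1].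
Proof.
case: x => [[|[|[|//]]] ?]; case: y => [[|[|[|//]]] ?];
  by [constructor 1; apply/val_inj | constructor 2; apply/val_inj
     | constructor 3; apply/val_inj].
Qed.

Lemma Z3_sub2 (x : 'Z_3) : x - 1 - 1 = x + 1.
Proof. by case: x => [[|[|[|//]]] ?]; apply/val_inj. Qed.

Lemma Z3_neq_up (x : 'Z_3) : x != x + 1.
Proof. by case: x => [[|[|[|//]]] ?]. Qed.

Lemma rpsxx (x : 'Z_3) : rps x x = x.
Proof. by case: x => [[|[|[|//]]] ?]. Qed.

Lemma rps_up (x : 'Z_3) : rps x (x + 1) = x.
Proof. by case: x => [[|[|[|//]]] ?]; apply/val_inj. Qed.

Lemma rps_down (x : 'Z_3) : rps x (x - 1) = x - 1.
Proof. by rewrite /rps eqxx. Qed.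

Lemma rpsC (x y : 'Z_3) : rps x y = rps y x.
Proof.
by case: x => [[|[|[|//]]] ?]; case: y => [[|[|[|//]]] ?]; apply/val_inj.
Qed.

Definition rps_colouring (V : finType) (T : rel V) (c : V -> 'Z_3) : Prop :=
  forall i j : V, c (match_winner T i j) = rps (c i) (c j).

Lemma rps_colouringP (V : finType) (T : rel V) (c : V -> 'Z_3) :
    tournament T -> (forall i j, c j = c i + 1 -> T i j) ->
  rps_colouring T c.
Proof.
move=> [_ asymT] beats i j; rewrite /match_winner.
have [cji|cji|cji] := Z3_cases (c i) (c j).
- by rewrite cji rpsxx; case: ifP.
- by rewrite beats // orbT cji rps_up.
have cij : c i = c j + 1 by rewrite cji subrK.
have ij : i != j.
  by apply/eqP => ij; have := Z3_neq_up (c j); rewrite -cij ij eqxx.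
have := asymT i j ij; rewrite (beats j i) // (negbTE ij) => /=.
by case: (T i j) => // _; rewrite cji rps_down.
Qed.

(** * Trees that compute with colours *)

Definition colour (V : finType) (T : rel V) (c : V -> 'Z_3)
    (t : voting_tree V) : 'Z_3 := c (winner T t).

Lemma colour_node (V : finType) (T : rel V) (c : V -> 'Z_3)
    (l r : voting_tree V) :
    rps_colouring T c ->
  colour T c (Node l r) = rps (colour T c l) (colour T c r).
Proof. by move=> Tc; apply: Tc. Qed.

Definition step (V : Type) (z : voting_tree V) (us : seq (voting_tree V)) :
    voting_tree V :=
  foldl (fun t u => Node t (Node z u)) z us.

(** A match of z against u has the colour of z, unless u has the colour just
    below, which beats it.  So at most two colours occur among the results and z
    itself, and the lower one wins if it is present. *)
Lemma colour_step (V : finType) (T : rel V) (c : V -> 'Z_3)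
    (z : voting_tree V) (us : seq (voting_tree V)) :
    rps_colouring T c ->
  colour T c (step z us) =
    if colour T c z - 1 \in map (colour T c) us then colour T c z - 1
    else colour T c z.
Proof.
move=> Tc; elim/last_ind: us => //= us u IHus.
rewrite /step foldl_rcons -/(step z us) !colour_node // {}IHus.
rewrite map_rcons mem_rcons inE; set x := colour T c z.
have -> : rps x (colour T c u) = if x - 1 == colour T c u then x - 1 else x.
  by rewrite /rps eq_sym; case: eqP.
by case: ifP => _; case: ifP => _; rewrite ?rpsxx ?rps_down // rpsC rps_down.
Qed.

Definition down (V : finType) (z : voting_tree V) : voting_tree V :=
  step z (map (@Leaf V) (enum V)).

Definition up (V : finType) (z : voting_tree V) : voting_tree V :=
  down (down z).

Definition all_colours (V : finType) (c : V -> 'Z_3) : Prop :=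
  forall x, exists i, c i = x.

Lemma colour_down (V : finType) (T : rel V) (c : V -> 'Z_3)
    (z : voting_tree V) :
    rps_colouring T c -> all_colours c ->
  colour T c (down z) = colour T c z - 1.
Proof.
move=> Tc c_onto; rewrite colour_step //; case: ifP => // /negP[].
have [i <-] := c_onto (colour T c z - 1).
by rewrite -map_comp; apply/mapP; exists i; rewrite ?mem_enum.
Qed.

Lemma colour_up (V : finType) (T : rel V) (c : V -> 'Z_3)
    (z : voting_tree V) :
    rps_colouring T c -> all_colours c ->
  colour T c (up z) = colour T c z + 1.
Proof. by move=> Tc c_onto; rewrite !colour_down // Z3_sub2. Qed.

(** * Selecting a repeated colour *)

Definition probes (V : finType) (x y : voting_tree V) : seq (voting_tree V) :=
  [:: x; y; Node (up x) y; Node (up y) x].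

(** If the colours differ, one is the other plus 1.  The higher one, raised
    again, is the third colour, and it beats the lower one. *)
Lemma colour_probes_neq (V : finType) (T : rel V) (c : V -> 'Z_3)
    (x y : voting_tree V) (k : 'Z_3) :
    rps_colouring T c -> all_colours c -> colour T c x != colour T c y ->
  k \in map (colour T c) (probes x y).
Proof.
move=> Tc c_onto; rewrite /probes /= !colour_node // !colour_up //.
move: (colour T c x) (colour T c y) => a b.
by case: a => [[|[|[|//]]] ?]; case: b => [[|[|[|//]]] ?];
  case: k => [[|[|[|//]]] ?].
Qed.

Lemma colour_probes_eq (V : finType) (T : rel V) (c : V -> 'Z_3)
    (x y : voting_tree V) (k : 'Z_3) :
    rps_colouring T c -> all_colours c -> colour T c x = colour T c y ->
  (k \in map (colour T c) (probes x y)) = (k == colour T c x).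
Proof.
move=> Tc c_onto xy; rewrite /probes /= !colour_node // !colour_up // -xy.
by rewrite rpsC rps_up !inE !orbb.
Qed.

Definition if_same (V : finType) (x y z : voting_tree V) : voting_tree V :=
  step (up (step (up z) (probes x y))) (probes x y).

(** Each step lowers the colour of z by 1, which undoes the [up] before it. *)
Lemma colour_if_same_neq (V : finType) (T : rel V) (c : V -> 'Z_3)
    (x y z : voting_tree V) :
    rps_colouring T c -> all_colours c -> colour T c x != colour T c y ->
  colour T c (if_same x y z) = colour T c z.
Proof.
move=> Tc c_onto xy; rewrite /if_same.
by do 2!rewrite colour_step // colour_probes_neq // colour_up // addrK.
Qed.

(** Let a be the common colour of x and y.  A step sends a + 1 to a and fixes
    the other two colours, so that the first step leaves a or a - 1; raising
    gives a + 1 or a, and the second step sends both to a. *)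
Lemma colour_if_same_eq (V : finType) (T : rel V) (c : V -> 'Z_3)
    (x y z : voting_tree V) :
    rps_colouring T c -> all_colours c -> colour T c x = colour T c y ->
  colour T c (if_same x y z) = colour T c x.
Proof.
move=> Tc c_onto xy; rewrite /if_same.
do 2!rewrite colour_step // colour_probes_eq // colour_up //.
move: (colour T c x) (colour T c z) => a b.
by case: a => [[|[|[|//]]] ?]; case: b => [[|[|[|//]]] ?]; apply/val_inj.
Qed.

Definition first_repeat (V : finType) (v0 : V) (s : seq (V * V)) :
    voting_tree V :=
  foldr (fun p t => if_same (Leaf p.1) (Leaf p.2) t) (Leaf v0) s.

Lemma colour_first_repeat (V : finType) (T : rel V) (c : V -> 'Z_3) (v0 : V)
    (s : seq (V * V)) :
    rps_colouring T c -> all_colours c -> has (fun p => c p.1 == c p.2) s ->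
  exists2 p, p \in s & c p.1 = c p.2 /\ colour T c (first_repeat v0 s) = c p.1.
Proof.
move=> Tc c_onto; elim: s => //= p s IHs.
have [cp _|cp /IHs[q sq [cq tq]]] := eqVneq (c p.1) (c p.2).
  by exists p; rewrite ?mem_head // colour_if_same_eq.
by exists q; rewrite ?inE ?sq ?orbT // colour_if_same_neq.
Qed.

Definition distinct_pairs (V : finType) : seq (V * V) :=
  [seq p <- enum {: V * V} | p.1 != p.2].

Lemma manipulator_loses (V : finType) (T : rel V) (a v0 : V) :
    (3 < #|V|)%N -> perfect_manipulator_tournament T a ->
  winner T (first_repeat v0 (distinct_pairs V)) <> a.
Proof.
move=> V_gt3 [tT [B [C [[B0 C0 [aB aC dBC cover]] [aTB BTC CTa]]]]].
pose c i : 'Z_3 := if i \in B then 1 else if i \in C then -1 else 0.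
have inBC i : i \in B -> i \in C = false by move/(disjointFr dBC).
have cB i : i \in B -> c i = 1 by rewrite /c => ->.
have cC i : i \in C -> c i = -1.
  by move=> iC; rewrite /c iC; case: ifP => // /inBC; rewrite iC.
have ca : c a = 0 by rewrite /c (negbTE aB) (negbTE aC).
have split i : [\/ i = a, i \in B | i \in C].
  have: i \in a |: (B :|: C) by rewrite cover inE.
  by rewrite !inE => /or3P[/eqP|?|?];
    [constructor 1 | constructor 2 | constructor 3].
have Tc : rps_colouring T c.
  apply: rps_colouringP => // i j.
  have [->|/[dup] ? /cB->|/[dup] ? /cC->] := split i;
    have [->|/[dup] ? /cB->|/[dup] ? /cC->] := split j;
    rewrite ?ca // => _; auto.
have c_onto : all_colours c.
  have [[b bB] [d dC]] := (set0Pn _ B0, set0Pn _ C0).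
  move=> x; have [->|->|->] := Z3_cases 0 x; first by exists a.
    by exists b; rewrite cB ?add0r.
  by exists d; rewrite cC ?add0r.
have [p pV cp] : exists2 p, p \in distinct_pairs V & c p.1 = c p.2.
  have /injectivePn[i [j ij cij]] : ~~ injectiveb c.
    by apply/negP => /injectiveP/leq_card; rewrite card_ord leqNgt V_gt3.
  by exists (i, j); rewrite // mem_filter ij mem_enum.
have [|q + [cq]] := colour_first_repeat (s := distinct_pairs V) v0 Tc c_onto.
  by apply/hasP; exists p => //; apply/eqP.
rewrite mem_filter /colour => /andP[q12 _] + wa; rewrite wa ca => cq0.
have only_a i : 0 = c i -> i = a.
  by have [->|/cB->|/cC->] := split i.
by rewrite (only_a q.1) // (only_a q.2) ?eqxx // -?cq in q12.
Qed.

Unset Implicit Arguments.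
Local Close Scope ring_scope.

Theorem theorem1p3 (n : nat) (n_ge4 : 4 <= n)
    (n_pow2 : exists k : nat, n = 2 ^ k) :
  exists Psi : voting_tree 'I_n,
    forall (alpha : 'I_n) (T : rel 'I_n),
      perfect_manipulator_tournament T alpha -> winner T Psi <> alpha.
Proof.
have v0 : 'I_n := Ordinal (ltn_trans (isT : 0 < 3) n_ge4).
exists (first_repeat v0 (distinct_pairs 'I_n)) => alpha T aT.
by apply: manipulator_loses; rewrite ?card_ord.
Qed.
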